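(* Let $A_i,B_i$ ($i=1,2,3,4$) be closed linear operators in a complex Hilbert space $\mathbb{H}$, $\mathcal{A}=\begin{pmatrix}A_1&A_2\\ A_3&A_4\end{pmatrix}$, $\mathcal{B}=\begin{pmatrix}B_1&B_2\\ B_3&B_4\end{pmatrix}$. For $\lambda\in\rho(A_1,B_1)$ put $S_2(\lambda)=(\lambda B_3-A_3)(\lambda B_1-A_1)^{-1}(\lambda B_2-A_2)+A_4$, $F_2(\lambda)=(\lambda B_3-A_3)(\lambda B_1-A_1)^{-1}$, $G_2(\lambda)=(\lambda B_1-A_1)^{-1}(\lambda B_2-A_2)$. Assume: (H1) the pencil $(A_1,B_1)$ is closed and densely defined, and $\rho(A_1,B_1)\neq\emptyset$; (H2) $D(A_1)\cap D(B_1)\subseteq D(A_3)\cap D(B_3)$ and $F_2(\lambda)$ is bounded for every $\lambda\in\rho(A_1,B_1)$; (H3) $G_2(\lambda)$ is bounded on $D(A_2)\cap D(B_2)$ for every $\lambda\in\rho(A_1,B_1)$; (H4) $D(A_2)\cap D(B_2)\cap D(A_4)\cap D(B_4)$ is dense and $\lambda B_4-S_2(\lambda)$ is closed for every $\lambda\in\rho(A_1,B_1)$. Let $\epsilon>0$. Then for every $\lambda\in\Lambda_\epsilon(\mathcal{A},\mathcal{B})\cap\rho(A_1,B_1)$, $$\lambda\in\Lambda_{\epsilon(1+\delta_1)(1+\delta_2)}(A_1,B_1)\cup\Lambda_{\epsilon(1+\delta_1)(1+\delta_2)}(S_2(\lambda),B_4),$$ where $\delta_1=\|(\lambda B_1-A_1)^{-1}(\lambda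 B_2-A_2)\|$ and $\delta_2=\|(\lambda B_3-A_3)(\lambda B_1-A_1)^{-1}\|$.
   Context: For operators $A,B$ in a Hilbert space and $\lambda\in\mathbb{C}$, the pencil $(A,B)$ is $\lambda\mapsto\lambda B-A$, with domain $D(A)\cap D(B)$; the pencil being closed and densely defined means that the operators $\lambda B-A$ on this domain are. $\rho(A,B)$ is the set of $\lambda\in\mathbb{C}$ for which $(\lambda B-A)^{-1}$ is a bounded everywhere-defined operator, $\sigma(A,B)=\mathbb{C}\setminus\rho(A,B)$, and for $\epsilon>0$, $\Lambda_\epsilon(A,B)=\sigma(A,B)\cup\{\lambda\in\mathbb{C}:\|(\lambda B-A)^{-1}\|\ge\epsilon^{-1}\}$. Block operators act in $\mathbb{H}\times\mathbb{H}$ (Hilbert direct sum norm) with $D(\mathcal{A})=(D(A_1)\cap D(A_3))\times(D(A_2)\cap D(A_4))$, $D(\mathcal{B})=(D(B_1)\cap D(B_3))\times(D(B_2)\cap D(B_4))$, and $\lambda\mathcal{B}-\mathcal{A}$ has entries $\lambda B_i-A_i$ and domain $D(\mathcal{A})\cap D(\mathcal{B})$. Operators built by sums and products have their natural domains, and norms are operator norms on those domains. In $\Lambda_{\eta}(S_2(\lambda),B_4)$ the operator $S_2(\lambda)$ is held fixed, so $\lambda\in\Lambda_{\eta}(S_2(\lambda),B_4)$ means that $\lambda B_4-S_2(\lambda)$ has no bounded everywhere-defined inverse or $\|(\lambda B_4-S_2(\lambda))^{-1}\|\ge\eta^{-1}$. *)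

(* Defs.v *)
From HB Require Import structures.
From mathcomp Require Import all_boot all_order all_algebra.
From mathcomp Require Import all_classical all_reals all_analysis.
From mathcomp Require Import complex ring.

Set Implicit Arguments.
Unset Strict Implicit.
Unset Printing Implicit Defensive.

Import Order.TTheory GRing.Theory Num.Theory.
Import numFieldNormedType.Exports.

Local Open Scope classical_set_scope.
Local Open Scope ring_scope.
Local Open Scope complex_scope.

HB.mixin Record NormedModule_isHilbert (R : realType) H
    & CompleteNormedModule R[i] H := {
  inner : {dot H for @Num.conj R[i]} ;
  inner_normE : forall x : H, inner x x = `|x| ^+ 2
}.

#[short(type="hilbertType")]
HB.structure Definition Hilbert (R : realType) :=
  {H of CompleteNormedModule R[i] H & NormedModule_isHilbert R H}.

(* The product [H1 * H2] carries the maximum norm in the library, so the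
   Hilbert direct sum is an alias with the norm
   [sqrt (`|x| ^+ 2 + `|y| ^+ 2)]. *)
Definition hsum (R : realType) (H1 H2 : hilbertType R) : Type := (H1 * H2)%type.

Section HilbertSum.
Context (R : realType) (H1 H2 : hilbertType R).
Local Notation C := R[i].
Local Notation S := (hsum H1 H2).

HB.instance Definition _ := GRing.Lmodule.copy S (H1 * H2)%type.

Definition hsum_norm (p : S) : C := sqrtC (`|p.1| ^+ 2 + `|p.2| ^+ 2).

Let sq_ge0 (p : S) : 0 <= `|p.1| ^+ 2 + `|p.2| ^+ 2 :> C.
Proof. by rewrite addr_ge0 // exprn_ge0. Qed.

Let hsum_norm_ge0 p : 0 <= hsum_norm p.
Proof. by rewrite sqrtC_ge0. Qed.

Let hsum_normE p : hsum_norm p ^+ 2 = `|p.1| ^+ 2 + `|p.2| ^+ 2.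
Proof. by rewrite sqrtCK. Qed.

Lemma minkowski2 (a b c d : C) : 0 <= a -> 0 <= b -> 0 <= c -> 0 <= d ->
  sqrtC ((a + c) ^+ 2 + (b + d) ^+ 2) <=
  sqrtC (a ^+ 2 + b ^+ 2) + sqrtC (c ^+ 2 + d ^+ 2).
Proof.
move=> a0 b0 c0 d0.
have sq2 (x y : C) : 0 <= x -> 0 <= y -> 0 <= x ^+ 2 + y ^+ 2.
  by move=> x0 y0; rewrite addr_ge0 // exprn_ge0.
have p0 := sq2 _ _ a0 b0; have q0 := sq2 _ _ c0 d0.
have sp0 : 0 <= sqrtC (a ^+ 2 + b ^+ 2) by rewrite sqrtC_ge0.
have sq0 : 0 <= sqrtC (c ^+ 2 + d ^+ 2) by rewrite sqrtC_ge0.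
rewrite -(@ler_pXn2r _ 2) ?nnegrE ?sqrtC_ge0 ?sq2 ?addr_ge0 //.
rewrite sqrtCK [leRHS]sqrrD !sqrtCK.
have le_cross : a * c + b * d <=
    sqrtC (a ^+ 2 + b ^+ 2) * sqrtC (c ^+ 2 + d ^+ 2).
  rewrite -(@ler_pXn2r _ 2) ?nnegrE ?addr_ge0 ?mulr_ge0 //.
  rewrite exprMn !sqrtCK -subr_ge0.
  have -> : (a ^+ 2 + b ^+ 2) * (c ^+ 2 + d ^+ 2) - (a * c + b * d) ^+ 2 =
            (a * d - b * c) ^+ 2 by ring.
  by rewrite -realEsqr rpredB // rpredM // ger0_real.
have -> : (a + c) ^+ 2 + (b + d) ^+ 2 =
  (a ^+ 2 + b ^+ 2) + (c ^+ 2 + d ^+ 2) + (a * c + b * d) *+ 2 by ring.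
by rewrite [leRHS]addrAC lerD2l lerMn2r.
Qed.

Let hsum_normD p q : hsum_norm (p + q) <= hsum_norm p + hsum_norm q.
Proof.
apply: (le_trans _ (minkowski2 _ _ _ _)) => //.
rewrite ler_sqrtC ?nnegrE ?addr_ge0 ?exprn_ge0 ?addr_ge0 //.
by apply: lerD; rewrite lerXn2r ?nnegrE ?addr_ge0 // ler_normD.
Qed.

Let hsum_normZ (l : C) p : hsum_norm (l *: p) = `|l| * hsum_norm p.
Proof.
by rewrite /hsum_norm /= !normrZ !exprMn -mulrDr sqrtCM ?nnegrE ?exprn_ge0 //
  sqrCK.
Qed.

Let hsum_norm0_eq0 p : hsum_norm p = 0 -> p = 0.
Proof.
move=> p0; have /eqP := hsum_normE p.
rewrite p0 expr0n /= eq_sym paddr_eq0 ?exprn_ge0 // !expf_eq0 /= !normr_eq0.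
by case: p {p0} => x y /= /andP[/eqP-> /eqP->].
Qed.

HB.instance Definition _ :=
  Lmodule_isNormed.Build C S hsum_normD hsum_normZ hsum_norm0_eq0.

Lemma hsum_normrE (p : S) : `|p| = sqrtC (`|p.1| ^+ 2 + `|p.2| ^+ 2).
Proof. by []. Qed.

Let hsum_norm_fst (p : S) : `|p.1| <= `|p|.
Proof.
rewrite -(@ler_pXn2r _ 2) ?nnegrE //.
by rewrite hsum_normrE sqrtCK lerDl exprn_ge0.
Qed.

Let hsum_norm_snd (p : S) : `|p.2| <= `|p|.
Proof.
rewrite -(@ler_pXn2r _ 2) ?nnegrE //.
by rewrite hsum_normrE sqrtCK lerDr exprn_ge0.
Qed.

Let hsum_norm_le (p : S) : `|p| <= `|p.1| + `|p.2|.
Proof.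
rewrite -(@ler_pXn2r _ 2) ?nnegrE ?addr_ge0 //.
by rewrite hsum_normrE sqrtCK sqrrD addrAC lerDl mulrn_wge0 // mulr_ge0.
Qed.

Let hsum_complete (F : set_system S) : ProperFilter F -> cauchy F -> cvg F.
Proof.
move=> FF /cauchy_ballP Fc.
have c1 : cauchy (@fst H1 H2 @ (F : set_system (H1 * H2)%type)).
  apply/cauchy_ballP => e e0; have [[P Q] /= [FP FQ] PQ] := Fc e e0.
  exists (fst @` P, fst @` Q);
    first by split; [apply: filterS FP|apply: filterS FQ] => z; exists z.
  move=> [_ _] /= [[p Pp <-] [q Qq <-]].
  have := PQ (p, q) (conj Pp Qq); rewrite -!ball_normE /=.
  by apply: le_lt_trans; exact: (hsum_norm_fst (p - q)).
have c2 : cauchy (@snd H1 H2 @ (F : set_system (H1 * H2)%type)).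
  apply/cauchy_ballP => e e0; have [[P Q] /= [FP FQ] PQ] := Fc e e0.
  exists (snd @` P, snd @` Q);
    first by split; [apply: filterS FP|apply: filterS FQ] => z; exists z.
  move=> [_ _] /= [[p Pp <-] [q Qq <-]].
  have := PQ (p, q) (conj Pp Qq); rewrite -!ball_normE /=.
  by apply: le_lt_trans; exact: (hsum_norm_snd (p - q)).
have Fx := @cauchy_cvg _ _ (fmap_proper_filter _ FF) c1.
have Fy := @cauchy_cvg _ _ (fmap_proper_filter _ FF) c2.
apply/cvg_ex; exists ((lim (@fst H1 H2 @ F), lim (@snd H1 H2 @ F)) : S).
apply/cvg_ballP => e e0.
have e2 : 0 < e / 2 by rewrite divr_gt0.
set x := lim _; set y := lim _.
have Fxe : F [set p : S | ball x (e / 2) p.1] by apply: cvg_ball Fx _ e2.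
have Fye : F [set p : S | ball y (e / 2) p.2] by apply: cvg_ball Fy _ e2.
apply: filterS2 Fxe Fye => p; rewrite -!ball_normE /= => xp yp.
rewrite [ltRHS](splitr e); apply: le_lt_trans (hsum_norm_le _) _ => /=.
exact: ltrD.
Qed.

HB.instance Definition _ := Uniform_isComplete.Build S hsum_complete.

Definition hsum_inner (p q : S) : C := inner p.1 q.1 + inner p.2 q.2.

Let hsum_inner_bilinear :
  bilinear_for *%R (@Num.conj C \; *%R) hsum_inner.
Proof.
split=> [q a p1 p2|p a q1 q2]; rewrite /hsum_inner /=.
  by rewrite !linearPl mulrDr addrACA.
by rewrite !linearP mulrDr addrACA.
Qed.

HB.instance Definition _ := bilinear_isBilinear.Build C S S C
  *%R (@Num.conj C \; *%R) hsum_inner hsum_inner_bilinear.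

Let hsum_innerC p q : hsum_inner p q = (-1) ^+ false * (hsum_inner q p)^*%R.
Proof.
rewrite mul1r /hsum_inner rmorphD /=.
by rewrite (hermC inner p.1) (hermC inner p.2) !mul1r.
Qed.

HB.instance Definition _ :=
  isHermitianSesquilinear.Build C S false (@Num.conj C) hsum_inner hsum_innerC.

Let hsum_inner_norm p : hsum_inner p p = `|p| ^+ 2.
Proof. by rewrite hsum_normrE sqrtCK /hsum_inner !inner_normE. Qed.

Let hsum_inner_gt0 p : p != 0 -> 0 < hsum_inner p p.
Proof. by move=> p0; rewrite hsum_inner_norm exprn_gt0 // normr_gt0. Qed.

HB.instance Definition _ := isDotProduct.Build C S hsum_inner hsum_inner_gt0.

HB.instance Definition _ :=
  NormedModule_isHilbert.Build R S hsum_inner_norm.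
End HilbertSum.

(* The values of [opfun] outside [opdom] are junk and never used. *)
Record poperator (V : Type) := POperator { opdom : set V ; opfun :> V -> V }.

Section Operators.
Context (R : realType) (H : hilbertType R).
Local Notation C := R[i].
Implicit Types (S T A B : poperator H) (l : C).

Definition rnorm (x : H) : R := complex.Re `|x|.

Definition graph T : set (H * H) := [set p | opdom T p.1 /\ T p.1 = p.2].

Definition linear_operator T : Prop :=
  opdom T 0 /\
  forall (a : C) x y, opdom T x -> opdom T y ->
    opdom T (a *: x + y) /\ T (a *: x + y) = a *: T x + T y.

Definition closed_operator T : Prop := closed (graph T).

Definition densely_defined T : Prop := dense (opdom T).

Definition bounded_operator T : Prop :=
  exists M : R, forall x, opdom T x -> rnorm (T x) <= M * rnorm x.

Definition opnorm T : \bar R :=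
  ereal_sup [set (rnorm (T x))%:E | x in [set x | opdom T x /\ rnorm x <= 1]].

Definition opadd S T : poperator H :=
  POperator (opdom S `&` opdom T) (fun x => S x + T x).

Definition opcomp S T : poperator H :=
  POperator (opdom T `&` T @^-1` opdom S) (fun x => S (T x)).

(* This is the inverse of [T] only when [T] is injective on its domain. *)
Definition opinv T : poperator H :=
  POperator (T @` opdom T) ('pinv_(fun=> 0) (opdom T) T).

Definition pencil l A B : poperator H :=
  POperator (opdom A `&` opdom B) (fun x => l *: B x - A x).

Definition boundedly_invertible T : Prop :=
  [/\ set_inj (opdom T) T, opdom (opinv T) = setT & bounded_operator (opinv T)].

Definition resolvent_set A B : set C :=
  [set l | boundedly_invertible (pencil l A B)].

Definition spectrum A B : set C := ~` resolvent_set A B.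

(* When [l] is in the spectrum the norm condition is immaterial, so the value of
   [opinv] on a non-injective operator plays no role. *)
Definition pseudospectrum (eps : R) A B : set C :=
  spectrum A B `|`
  [set l | ((eps^-1)%:E <= opnorm (opinv (pencil l A B)))%E].

End Operators.

Definition block (R : realType) (H : hilbertType R)
    (T1 T2 T3 T4 : poperator H) : poperator (hsum H H) :=
  @POperator (hsum H H)
    [set p | (opdom T1 `&` opdom T3) p.1 /\ (opdom T2 `&` opdom T4) p.2]
    (fun p => (T1 p.1 + T2 p.2, T3 p.1 + T4 p.2)).

(* Main.v *)
Require Import Defs.
From HB Require Import structures.
From mathcomp Require Import all_boot all_order all_algebra.
From mathcomp Require Import all_classical all_reals all_analysis.
From mathcomp Require Import complex.

Set Implicit Arguments.
Unset Strict Implicit.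
Unset Printing Implicit Defensive.

Import Order.TTheory GRing.Theory Num.Theory.
Import numFieldNormedType.Exports.

Local Open Scope classical_set_scope.
Local Open Scope ring_scope.
Local Open Scope complex_scope.

(** The proof is by contraposition.  Write [P1], [P2], [P3], [P4] for the entries
    of the pencil at [l], [F = P3 P1^-1], [G = P1^-1 P2], and let
    [M = P4 - P3 P1^-1 P2] be the Schur complement of [P1].  The pencil of [S2 l]
    and [B4] at [l] is exactly [M], with the same domain ([pencil_schur]), and the
    block pencil factors as

      [[I 0; F I] [P1 0; 0 M] [I G; 0 I]].

    If [l] lies in neither of the two pseudospectra of the conclusion, then [P1]
    and [M] are boundedly invertible, with inverses of norm smaller than
    [eta^-1].  Inverting the three factors produces the inverse of the block
    pencil explicitly ([block_inverseK], [block_inverseP]).  Its norm is at most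
    [(1 + ||G||) * (1 + ||F||)] times the larger of the norms of [P1^-1] and
    [M^-1] ([rnorm_block_inverse_le]): the triangular factors contribute
    [1 + ||G||] and [1 + ||F||], and the diagonal factor contributes the maximum
    because the direct sum carries the Hilbert norm.  As
    [eta = eps * (1 + ||G||) * (1 + ||F||)], this is smaller than [eps^-1], so [l]
    is not in the [eps]-pseudospectrum of the block pencil.

    [G] is bounded on its own domain, which need not be the whole space.  This
    is enough, since the inverse applies [G] only to vectors in the range of
    [M^-1], which is contained in that domain. *)

(** * Norms on the Hilbert space and on the Hilbert direct sum *)

Section RealNorm.
Context (R : realType) (H : hilbertType R).
Implicit Types x y : H.

Lemma rnormE x : (rnorm x)%:C = `|x|.
Proof. by rewrite /rnorm RRe_real // ger0_real. Qed.

Lemma rnorm_ge0 x : 0 <= rnorm x.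
Proof. by rewrite -lecR rnormE rmorph0. Qed.

Lemma rnorm0 : rnorm (0 : H) = 0.
Proof. by rewrite /rnorm normr0. Qed.

Lemma rnorm_eq0 x : rnorm x = 0 -> x = 0.
Proof. by move=> x0; apply/normr0_eq0; rewrite -rnormE x0. Qed.

Lemma ler_rnormD x y : rnorm (x + y) <= rnorm x + rnorm y.
Proof. by rewrite -lecR rmorphD /= !rnormE ler_normD. Qed.

Lemma rnormN x : rnorm (- x) = rnorm x.
Proof. by rewrite /rnorm normrN. Qed.

Lemma rnormZ (c : R) x : 0 <= c -> rnorm (c%:C *: x) = c * rnorm x.
Proof.
move=> c0; apply: complexI; rewrite rmorphM /= !rnormE normrZ.
by rewrite ger0_norm // lecR.
Qed.

End RealNorm.

Section HilbertSumNorm.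
Context (R : realType) (H1 H2 : hilbertType R).
Implicit Types p : hsum H1 H2.

Lemma hsum_rnorm_sqr p : rnorm p ^+ 2 = rnorm p.1 ^+ 2 + rnorm p.2 ^+ 2.
Proof.
apply: complexI; rewrite rmorphD !rmorphXn /= !rnormE.
by rewrite hsum_normrE sqrtCK.
Qed.

Lemma hsum_rnorm_snd_le p : rnorm p.2 <= rnorm p.
Proof.
rewrite -(@ler_pXn2r _ 2) ?nnegrE ?rnorm_ge0 //.
by rewrite hsum_rnorm_sqr lerDr exprn_ge0 // rnorm_ge0.
Qed.

Lemma hsum_rnorm_fst_le p : rnorm p.1 <= rnorm p.
Proof.
rewrite -(@ler_pXn2r _ 2) ?nnegrE ?rnorm_ge0 //.
by rewrite hsum_rnorm_sqr lerDl exprn_ge0 // rnorm_ge0.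
Qed.

Lemma hsum_rnorm_fst0 (x : H1) : rnorm ((x, 0) : hsum H1 H2) = rnorm x.
Proof.
apply/eqP; rewrite -(@eqrXn2 _ 2) ?rnorm_ge0 //.
by rewrite hsum_rnorm_sqr /= rnorm0 expr0n /= addr0.
Qed.

Lemma hsum_rnorm_snd0 (y : H2) : rnorm ((0, y) : hsum H1 H2) = rnorm y.
Proof.
apply/eqP; rewrite -(@eqrXn2 _ 2) ?rnorm_ge0 //.
by rewrite hsum_rnorm_sqr /= rnorm0 expr0n /= add0r.
Qed.

(** A diagonal block operator is bounded by the larger of the bounds of its
    entries; the direct sum norm loses no constant here. *)
Lemma ler_hsum_diag (c : R) (p q : hsum H1 H2) : 0 <= c ->
  rnorm p.1 <= c * rnorm q.1 -> rnorm p.2 <= c * rnorm q.2 ->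
  rnorm p <= c * rnorm q.
Proof.
move=> c0 h1 h2; rewrite -(@ler_pXn2r _ 2) ?nnegrE ?mulr_ge0 ?rnorm_ge0 //.
rewrite exprMn !hsum_rnorm_sqr mulrDr -!exprMn.
by apply: lerD; rewrite ler_pXn2r ?nnegrE ?mulr_ge0 ?rnorm_ge0.
Qed.

(** Bound for the triangular factor with rows [(I, - G)] and [(0, I)], where [z]
    stands for [G y]: the factor moves [(x, y)] by the vector [(- z, 0)], whose
    norm is at most [c * rnorm y].  The bound on [G] enters only at the vector [y]
    at hand, so [G] may have a domain that is not the whole space. *)
Lemma ler_hsum_shear_fst (c : R) (x z : H1) (y : H2) : 0 <= c ->
  rnorm z <= c * rnorm y ->
  rnorm ((x - z, y) : hsum H1 H2) <= (1 + c) * rnorm ((x, y) : hsum H1 H2).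
Proof.
move=> c0 h.
have -> : ((x - z, y) : hsum H1 H2) = ((x, y) : hsum H1 H2) + (- z, 0).
  by congr pair; rewrite /= addr0.
apply: le_trans (ler_rnormD _ _) _; rewrite mulrDl mul1r lerD2l.
rewrite hsum_rnorm_fst0 rnormN (le_trans h) // ler_wpM2l //.
exact: (hsum_rnorm_snd_le (x, y)).
Qed.

(** The same for the factor with rows [(I, 0)] and [(- F, I)]; here [z] stands
    for [F x]. *)
Lemma ler_hsum_shear_snd (c : R) (x : H1) (y z : H2) : 0 <= c ->
  rnorm z <= c * rnorm x ->
  rnorm ((x, y - z) : hsum H1 H2) <= (1 + c) * rnorm ((x, y) : hsum H1 H2).
Proof.
move=> c0 h.
have -> : ((x, y - z) : hsum H1 H2) = ((x, y) : hsum H1 H2) + (0, - z).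
  by congr pair; rewrite /= addr0.
apply: le_trans (ler_rnormD _ _) _; rewrite mulrDl mul1r lerD2l.
rewrite hsum_rnorm_snd0 rnormN (le_trans h) // ler_wpM2l //.
exact: (hsum_rnorm_fst_le (x, y)).
Qed.

End HilbertSumNorm.

(** * Linear operators, inverses and operator norms *)

Section LinearOperators.
Context (R : realType) (H : hilbertType R).
Implicit Types S T A B : poperator H.

Lemma poperator_eq (V : Type) (S T : poperator V) :
  opdom S = opdom T -> opfun S =1 opfun T -> S = T.
Proof. by case: S T => [D f] [E g] /= -> /funext ->. Qed.

Section Values.
Context (T : poperator H) (linT : linear_operator T).

Lemma opdom0 : opdom T 0. Proof. by case: linT. Qed.

Lemma opdomD x y : opdom T x -> opdom T y -> opdom T (x + y).
Proof. by move=> Tx Ty; have [+ _] := linT.2 1 _ _ Tx Ty; rewrite scale1r. Qed.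

Lemma opfunD x y : opdom T x -> opdom T y -> T (x + y) = T x + T y.
Proof. by move=> Tx Ty; have [_] := linT.2 1 _ _ Tx Ty; rewrite !scale1r. Qed.

Lemma opfun0 : T 0 = 0.
Proof.
by apply: (@addIr _ (T 0)); rewrite -opfunD ?addr0 ?add0r //; exact: opdom0.
Qed.

Lemma opdomZ a x : opdom T x -> opdom T (a *: x).
Proof. by move=> Tx; have [+ _] := linT.2 a _ _ Tx opdom0; rewrite addr0. Qed.

Lemma opfunZ a x : opdom T x -> T (a *: x) = a *: T x.
Proof.
by move=> Tx; have [_] := linT.2 a _ _ Tx opdom0; rewrite opfun0 !addr0.
Qed.

Lemma opdomN x : opdom T x -> opdom T (- x).
Proof. by move=> /(opdomZ (-1)); rewrite scaleN1r. Qed.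

Lemma opfunN x : opdom T x -> T (- x) = - T x.
Proof. by move=> Tx; rewrite -scaleN1r opfunZ // scaleN1r. Qed.

Lemma opdomB x y : opdom T x -> opdom T y -> opdom T (x - y).
Proof. by move=> Tx /opdomN; exact: opdomD. Qed.

Lemma opfunB x y : opdom T x -> opdom T y -> T (x - y) = T x - T y.
Proof. by move=> Tx Ty; rewrite opfunD ?opfunN //; exact: opdomN. Qed.

End Values.

Lemma linear_pencil l A B :
  linear_operator A -> linear_operator B -> linear_operator (pencil l A B).
Proof.
move=> linA linB; split; first by split; apply: opdom0.
move=> a x y [/= Ax Bx] [Ay By].
have [dA ->] := linA.2 a _ _ Ax Ay; have [dB ->] := linB.2 a _ _ Bx By.
split=> //; rewrite scalerDr scalerBr !scalerA (mulrC l a) opprD.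
by rewrite addrACA.
Qed.

Lemma linear_opcomp S T :
  linear_operator S -> linear_operator T -> linear_operator (opcomp S T).
Proof.
move=> linS linT; split.
  by split; rewrite /= ?opfun0 //; apply: opdom0.
move=> a x y [/= Tx STx] [Ty STy].
have [dT eT] := linT.2 a _ _ Tx Ty; have [dS eS] := linS.2 a _ _ STx STy.
by split; [split|]; rewrite /= ?eT.
Qed.

Lemma linear_opadd S T :
  linear_operator S -> linear_operator T -> linear_operator (opadd S T).
Proof.
move=> linS linT; split; first by split; apply: opdom0.
move=> a x y [/= Sx Tx] [Sy Ty].
have [dS ->] := linS.2 a _ _ Sx Sy; have [dT ->] := linT.2 a _ _ Tx Ty.
by split=> //; rewrite scalerDr addrACA.
Qed.

Section Inverse.
Context (T : poperator H) (injT : set_inj (opdom T) T).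

Lemma opinvK x : opdom T x -> opinv T (T x) = x.
Proof. by move=> Tx; apply: pinvKV => //; rewrite inE. Qed.

Lemma opinvP y : opdom (opinv T) y ->
  opdom T (opinv T y) /\ T (opinv T y) = y.
Proof. by move=> [x Tx <-]; rewrite opinvK. Qed.

Lemma linear_opinv : linear_operator T -> linear_operator (opinv T).
Proof.
move=> linT; split.
  by exists 0; [exact: opdom0|exact: opfun0].
move=> a _ _ [x Tx <-] [y Ty <-]; rewrite !opinvK //.
have [d e] := linT.2 a _ _ Tx Ty.
by split; [exists (a *: x + y)|rewrite -e opinvK].
Qed.

End Inverse.

(** The values of [opinv T] are chosen among preimages, hence determined only
    once [T] is known to be injective; a two-sided inverse [f] gives injectivity
    and then identifies [opinv T]. *)
Lemma opinv_unique T (f : H -> H) :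
  (forall x, opdom T x -> f (T x) = x) ->
  (forall y, opdom T (f y) /\ T (f y) = y) ->
  [/\ set_inj (opdom T) T, opdom (opinv T) = setT & opinv T =1 f].
Proof.
move=> fK fP; have injT : set_inj (opdom T) T.
  by move=> x y; rewrite !inE => /fK {2}<- /fK {2}<- ->.
split=> // [|y].
  by apply/seteqP; split=> // y _; have [Tfy <-] := fP y; exists (f y).
by have [Tfy {1}<-] := fP y; rewrite opinvK.
Qed.

Section OperatorNorm.
Context (T : poperator H).

Lemma opnorm_le_bound (M : R) : 0 <= M ->
  (forall x, opdom T x -> rnorm (T x) <= M * rnorm x) ->
  (opnorm T <= M%:E)%E.
Proof.
move=> M0 h; apply: ge_ereal_sup => _ [x [Tx x1] <-].
rewrite lee_fin; apply: le_trans (h _ Tx) _.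
by rewrite ler_piMr.
Qed.

Hypothesis linT : linear_operator T.

Lemma opnorm_ge0 : (0 <= opnorm T)%E.
Proof.
apply: ereal_sup_ubound; exists 0; last by rewrite opfun0 // rnorm0.
by split; [exact: opdom0|rewrite rnorm0].
Qed.

Hypothesis bndT : bounded_operator T.

Lemma opnorm_fin_num : opnorm T \is a fin_num.
Proof.
case: bndT => M hM; rewrite ge0_fin_numE ?opnorm_ge0 //.
apply: (@le_lt_trans _ _ (`|M|)%:E); last exact: ltry.
apply: opnorm_le_bound => // x /hM /le_trans; apply.
by rewrite ler_wpM2r ?rnorm_ge0 // ler_norm.
Qed.

Lemma fine_opnorm_ge0 : 0 <= fine (opnorm T).
Proof. exact: fine_ge0 opnorm_ge0. Qed.

(** [opnorm T] is a supremum over the unit ball of the domain, so the estimate at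
    [x] comes from homogeneity, by rescaling [x] to norm one. *)
Lemma rnorm_op_le x : opdom T x -> rnorm (T x) <= fine (opnorm T) * rnorm x.
Proof.
move=> Tx; have [x0|] := eqVneq (rnorm x) 0.
  by rewrite x0 mulr0 (rnorm_eq0 x0) opfun0 // rnorm0.
move=> nx0; have x_gt0 : 0 < rnorm x by rewrite lt_neqAle eq_sym nx0 rnorm_ge0.
have c0 : 0 <= (rnorm x)^-1 by rewrite invr_ge0 rnorm_ge0.
rewrite -ler_pdivrMr // mulrC -rnormZ // -opfunZ //.
rewrite -lee_fin fineK ?opnorm_fin_num //; apply: ereal_sup_ubound.
exists ((rnorm x)^-1%:C *: x) => //; split; first exact: opdomZ.
by rewrite rnormZ // mulVf.
Qed.

End OperatorNorm.

Lemma notin_pseudospectrum eps A B l : ~ pseudospectrum eps A B l ->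
  boundedly_invertible (pencil l A B) /\
  (opnorm (opinv (pencil l A B)) < (eps^-1)%:E)%E.
Proof.
move=> /not_orP[/contrapT inv /negP]; rewrite -ltNge => lt.
by split.
Qed.

End LinearOperators.

(** * The inverse of a block operator through its Schur complement *)

Lemma pencil_block (R : realType) (H : hilbertType R)
    (A1 A2 A3 A4 B1 B2 B3 B4 : poperator H) (l : R[i]) :
  pencil l (block A1 A2 A3 A4) (block B1 B2 B3 B4) =
  block (pencil l A1 B1) (pencil l A2 B2) (pencil l A3 B3) (pencil l A4 B4).
Proof.
apply: poperator_eq => [|p /=]; first by apply/seteqP; split=> p /=; tauto.
by congr pair; rewrite /= scalerDr opprD addrACA.
Qed.

Definition schur (R : realType) (H : hilbertType R)
    (T1 T2 T3 T4 : poperator H) : poperator H :=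
  POperator (opdom T2 `&` opdom T4)
            (fun y => T4 y - T3 (opinv T1 (T2 y))).

(** The natural domain of [T3 T1^-1 T2] is that of [T2]: [T1^-1] is everywhere
    defined and takes its values in [opdom T1], which lies in [opdom T3].  The
    pencil on the left is therefore the Schur complement of [T1]. *)
Lemma pencil_schur (R : realType) (H : hilbertType R)
    (A4 B4 T1 T2 T3 : poperator H) (l : R[i]) :
  opdom T1 `<=` opdom T3 -> boundedly_invertible T1 ->
  pencil l (opadd (opcomp T3 (opcomp (opinv T1) T2)) A4) B4 =
  schur T1 T2 T3 (pencil l A4 B4).
Proof.
move=> T13 [inj1 dom1 _]; apply: poperator_eq => [|y /=].
  have dT x : opdom (opinv T1) x by rewrite dom1.
  apply/seteqP; split=> y /=; first tauto.
  move=> [T2y [A4y B4y]]; do !split=> //; rewrite /preimage /=.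
    exact: dT.
  by apply: T13; have [] := opinvP inj1 (dT (T2 y)).
by rewrite opprD (addrC (- _)) addrA.
Qed.

Section BlockInverse.
Context (R : realType) (H : hilbertType R) (T1 T2 T3 T4 : poperator H).
Hypotheses (lin1 : linear_operator T1) (lin3 : linear_operator T3).
Hypothesis dom13 : opdom T1 `<=` opdom T3.
Hypothesis inv1 : boundedly_invertible T1.
Local Notation M := (schur T1 T2 T3 T4).
Local Notation T := (block T1 T2 T3 T4).
Hypothesis invM : boundedly_invertible M.

Let inj1 : set_inj (opdom T1) T1. Proof. by case: inv1. Qed.
Let dom1 u : opdom (opinv T1) u. Proof. by case: inv1 => _ ->. Qed.
Let injM : set_inj (opdom M) M. Proof. by case: invM. Qed.
Let domM v : opdom (opinv M) v. Proof. by case: invM => _ ->. Qed.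
Let linV1 : linear_operator (opinv T1). Proof. exact: linear_opinv. Qed.
Let ran1 u : opdom T1 (opinv T1 u). Proof. exact: (opinvP inj1 _).1. Qed.
Let ran3 u : opdom T3 (opinv T1 u). Proof. exact/dom13/ran1. Qed.

(** Reading the factorization of [T] into unitriangular and diagonal parts
    backwards: with [F = T3 T1^-1] and [G = T1^-1 T2], the inverse sends [(u, v)]
    to [(T1^-1 u - G y, y)], where [y = M^-1 (v - F u)]. *)
Definition block_inverse (q : hsum H H) : hsum H H :=
  let y := opinv M (q.2 - T3 (opinv T1 q.1)) in
  (opinv T1 q.1 - opinv T1 (T2 y), y).

Lemma block_inverseK p : opdom T p -> block_inverse (T p) = p.
Proof.
case: p => x y [/= [T1x T3x] [T2y T4y]].
have ex : opinv T1 (T1 x + T2 y) = x + opinv T1 (T2 y).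
  by rewrite (opfunD linV1) // opinvK.
set w := T3 x + T4 y - T3 (opinv T1 (T1 x + T2 y)).
have ey : opinv M w = y.
  rewrite /w ex (opfunD lin3) // opprD addrA (addrC (T3 x)) addrK.
  exact: (@opinvK _ _ M).
transitivity (opinv T1 (T1 x + T2 y) - opinv T1 (T2 (opinv M w)), opinv M w).
  by [].
by rewrite ey ex addrK.
Qed.

Lemma block_inverseP q :
  opdom T (block_inverse q) /\ T (block_inverse q) = q.
Proof.
case: q => u v; rewrite /block_inverse [(u, v).1]/= [(u, v).2]/=.
set y := opinv M _.
have [[T2y T4y] My] : (opdom T2 `&` opdom T4) y /\
    T4 y - T3 (opinv T1 (T2 y)) = v - T3 (opinv T1 u).
  exact: (@opinvP _ _ M).
have V1 w : T1 (opinv T1 w) = w by have [] := opinvP inj1 (dom1 w).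
have T1x := opdomB lin1 (ran1 u) (ran1 (T2 y)).
split; first by do !split => //; exact: dom13.
transitivity (T1 (opinv T1 u - opinv T1 (T2 y)) + T2 y,
              T3 (opinv T1 u - opinv T1 (T2 y)) + T4 y); first by [].
rewrite (opfunB lin1) // (opfunB lin3) // !V1 subrK addrAC -addrA My.
by rewrite addrC subrK.
Qed.

Variables (c dF dG : R).
Hypotheses (c_ge0 : 0 <= c) (dF_ge0 : 0 <= dF) (dG_ge0 : 0 <= dG).
Hypothesis bndV1 : forall u, rnorm (opinv T1 u) <= c * rnorm u.
Hypothesis bndVM : forall v, rnorm (opinv M v) <= c * rnorm v.
Hypothesis bndF : forall u, rnorm (T3 (opinv T1 u)) <= dF * rnorm u.
Hypothesis bndG : forall y, opdom T2 y ->
  rnorm (opinv T1 (T2 y)) <= dG * rnorm y.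

(** [block_inverse] is a product of three factors: the shear by [- F], the
    diagonal operator with entries [T1^-1] and [M^-1], and the shear by [- G].
    The three factors of the constant are their bounds. *)
Lemma rnorm_block_inverse_le q :
  rnorm (block_inverse q) <= c * (1 + dG) * (1 + dF) * rnorm q.
Proof.
case: q => u v; rewrite /block_inverse [(u, v).1]/= [(u, v).2]/=.
set w := v - T3 (opinv T1 u); set y := opinv M w.
have T2y : opdom T2 y by have [[]] := opinvP injM (domM w).
have := ler_hsum_shear_fst (opinv T1 u) dG_ge0 (bndG T2y).
move/le_trans; apply; rewrite (mulrC c) -!mulrA ler_wpM2l ?addr_ge0 //.
apply: (@le_trans _ _ (c * rnorm ((u, w) : hsum H H))).
  by apply: ler_hsum_diag => //; [exact: bndV1|exact: bndVM].
by rewrite ler_wpM2l // ler_hsum_shear_snd.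
Qed.

Lemma block_boundedly_invertible :
  boundedly_invertible T /\
  (opnorm (opinv T) <= (c * (1 + dG) * (1 + dF))%:E)%E.
Proof.
have [injT domT VT] := opinv_unique block_inverseK block_inverseP.
have le q : rnorm (opinv T q) <= c * (1 + dG) * (1 + dF) * rnorm q.
  by rewrite VT rnorm_block_inverse_le.
split; first by split=> //; exists (c * (1 + dG) * (1 + dF)).
by apply: opnorm_le_bound => //; rewrite !mulr_ge0 ?addr_ge0.
Qed.

End BlockInverse.

Theorem theorem3p4 (R : realType) (H : hilbertType R)
    (A1 A2 A3 A4 B1 B2 B3 B4 : poperator H) :
  let P1 := fun l : R[i] => pencil l A1 B1 in
  let P2 := fun l : R[i] => pencil l A2 B2 in
  let P3 := fun l : R[i] => pencil l A3 B3 in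
  let F2 := fun l : R[i] => opcomp (P3 l) (opinv (P1 l)) in
  let G2 := fun l : R[i] => opcomp (opinv (P1 l)) (P2 l) in
  let S2 := fun l : R[i] =>
    opadd (opcomp (P3 l) (opcomp (opinv (P1 l)) (P2 l))) A4 in
  let rho1 := resolvent_set A1 B1 in
  let cA := block A1 A2 A3 A4 in
  let cB := block B1 B2 B3 B4 in
  forall
    (A1_lin : linear_operator A1) (A1_closed : closed_operator A1)
    (A2_lin : linear_operator A2) (A2_closed : closed_operator A2)
    (A3_lin : linear_operator A3) (A3_closed : closed_operator A3)
    (A4_lin : linear_operator A4) (A4_closed : closed_operator A4)
    (B1_lin : linear_operator B1) (B1_closed : closed_operator B1)
    (B2_lin : linear_operator B2) (B2_closed : closed_operator B2)
    (B3_lin : linear_operator B3) (B3_closed : closed_operator B3)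
    (B4_lin : linear_operator B4) (B4_closed : closed_operator B4)
    (H1_closed : forall l : R[i], closed_operator (P1 l))
    (H1_dense : forall l : R[i], densely_defined (P1 l))
    (H1_rho : rho1 !=set0)
    (H2_dom : opdom A1 `&` opdom B1 `<=` opdom A3 `&` opdom B3)
    (H2_bounded : forall l, rho1 l -> bounded_operator (F2 l))
    (H3_bounded : forall l, rho1 l -> bounded_operator (G2 l))
    (H4_dense : dense (opdom A2 `&` opdom B2 `&` opdom A4 `&` opdom B4))
    (H4_closed : forall l, rho1 l -> closed_operator (pencil l (S2 l) B4))
    (eps : R) (eps_gt0 : 0 < eps) (l : R[i]),
  (pseudospectrum eps cA cB `&` rho1) l ->
  let delta1 := fine (opnorm (G2 l)) in
  let delta2 := fine (opnorm (F2 l)) in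
  let eta := eps * (1 + delta1) * (1 + delta2) in
  (pseudospectrum eta A1 B1 `|` pseudospectrum eta (S2 l) B4) l.
Proof.
move=> P1 P2 P3 F2 G2 S2 rho1 cA cB.
move=> A1_lin _ A2_lin _ A3_lin _ A4_lin _ B1_lin _ B2_lin _ B3_lin _ B4_lin _.
move=> _ _ _ H2_dom H2_bounded H3_bounded _ _ eps eps_gt0 l [ps rho1l].
move=> delta1 delta2 eta.
have linP1 : linear_operator (P1 l) by exact: linear_pencil.
have linP2 : linear_operator (P2 l) by exact: linear_pencil.
have linP3 : linear_operator (P3 l) by exact: linear_pencil.
have linP4 : linear_operator (pencil l A4 B4) by exact: linear_pencil.
have inj1 : set_inj (opdom (P1 l)) (P1 l) by case: rho1l.
have linV1 : linear_operator (opinv (P1 l)) by exact: linear_opinv.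
have dom1 u : opdom (opinv (P1 l)) u by case: rho1l => _ ->.
have linF : linear_operator (F2 l) by exact: linear_opcomp.
have linG : linear_operator (G2 l) by exact: linear_opcomp.
have linS : linear_operator (pencil l (S2 l) B4).
  apply: linear_pencil => //; apply: linear_opadd => //.
  exact: linear_opcomp.
have domF u : opdom (F2 l) u.
  by split=> //; apply: H2_dom; have [] := opinvP inj1 (dom1 u).
have delta1_ge0 : 0 <= delta1 by apply: fine_opnorm_ge0.
have delta2_ge0 : 0 <= delta2 by apply: fine_opnorm_ge0.
have k_gt0 : 0 < (1 + delta1) * (1 + delta2).
  by rewrite mulr_gt0 // ltr_pwDl.
(* Both inverses have norm below [eta^-1]; [c] is the larger of the two norms. *)
apply: contrapT => /not_orP[/notin_pseudospectrum[_ lt1]].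
move=> /notin_pseudospectrum[invM ltM].
have linVM := linear_opinv (let: And3 i _ _ := invM in i) linS.
have bnd1 := rnorm_op_le linV1 (let: And3 _ _ b := rho1l in b).
have bndM := rnorm_op_le linVM (let: And3 _ _ b := invM in b).
have fin1 := opnorm_fin_num linV1 (let: And3 _ _ b := rho1l in b).
have finM := opnorm_fin_num linVM (let: And3 _ _ b := invM in b).
pose c := Num.max (fine (opnorm (opinv (P1 l))))
  (fine (opnorm (opinv (pencil l (S2 l) B4)))).
have c_lt : c < eta^-1.
  by rewrite gt_max -!lte_fin !fineK // lt1.
have c_ge0 : 0 <= c by rewrite le_max fine_opnorm_ge0.
have domM v : opdom (opinv (pencil l (S2 l) B4)) v by case: invM => _ ->.
have bnd1' u : rnorm (opinv (P1 l) u) <= c * rnorm u.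
  apply: le_trans (bnd1 _ (dom1 u)) _.
  by rewrite ler_wpM2r ?rnorm_ge0 // le_max lexx.
have bndM' v : rnorm (opinv (pencil l (S2 l) B4) v) <= c * rnorm v.
  apply: le_trans (bndM _ (domM v)) _.
  by rewrite ler_wpM2r ?rnorm_ge0 // le_max lexx orbT.
have eS : pencil l (S2 l) B4 = schur (P1 l) (P2 l) (P3 l) (pencil l A4 B4).
  exact: pencil_schur.
rewrite eS in invM bndM'.
have bndF u : rnorm (P3 l (opinv (P1 l) u)) <= delta2 * rnorm u.
  by apply: (rnorm_op_le linF); [exact: H2_bounded|exact: domF].
have bndG y : opdom (P2 l) y ->
    rnorm (opinv (P1 l) (P2 l y)) <= delta1 * rnorm y.
  move=> P2y; apply: (rnorm_op_le linG); first exact: H3_bounded.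
  by split=> //; exact: dom1.
have [invT] := block_boundedly_invertible linP1 linP3 H2_dom rho1l invM
  c_ge0 delta2_ge0 delta1_ge0 bnd1' bndM' bndF bndG.
rewrite -pencil_block => leT.
case: ps => [|/= geT]; first by apply; rewrite /resolvent_set /= pencil_block.
have := le_trans geT leT; rewrite lee_fin leNgt => /negP; apply.
rewrite -mulrA -ltr_pdivlMr // -invfM.
by move: c_lt; rewrite /eta mulrA.
Qed.
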